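(* For every pair of real numbers $a<b$ and every $r>0$, $$g(ra,rb)\geq r\,g(a,b)\quad\text{if and only if}\quad r\geq 1 .$$
   Context: $\mu$ is the standard Cauchy probability measure on $\mathbb{R}$, with density $f(x)=\frac{1}{\pi(1+x^2)}$; $\mu(a,b)$ denotes the measure of the interval $(a,b)$. For real $a<b$, $g(a,b)$ is the unique real number with $\mu(-\infty,g(a,b))=\mu(a,b)$. *)

(* Defs.v *)
From HB Require Import structures.
From mathcomp Require Import all_boot all_order all_algebra.
From mathcomp Require Import all_classical all_reals all_analysis.
From mathcomp Require Import measurable_realfun.

Set Implicit Arguments.
Unset Strict Implicit.
Unset Printing Implicit Defensive.

Import Order.TTheory GRing.Theory Num.Theory.
Import numFieldNormedType.Exports.

Local Open Scope classical_set_scope.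
Local Open Scope ring_scope.

Definition cauchy_pdf {R : realType} (x : R) : R := (pi * (1 + x ^+ 2))^-1.

Definition cauchy_prob {R : realType} : set (measurableTypeR R) -> \bar R :=
  fun V => (\int[lebesgue_measure]_(x in V) (cauchy_pdf x)%:E)%E.

Section cauchy_probability.
Context {R : realType}.
Notation mu := (@lebesgue_measure R).

Let pdfE : @cauchy_pdf R = (fun x => pi^-1 * (oneDsqr x)^-1).
Proof. by apply/funext => x; rewrite /cauchy_pdf invfM. Qed.

Lemma cauchy_pdf_ge0 (x : R) : 0 <= cauchy_pdf x.
Proof. by rewrite pdfE mulr_ge0// invr_ge0// pi_ge0. Qed.

Lemma continuous_cauchy_pdf : continuous (@cauchy_pdf R).
Proof.
rewrite pdfE => x; apply: cvgM; first exact: cvg_cst.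
exact: continuous_oneDsqrV.
Qed.

Lemma measurable_cauchy_pdf : measurable_fun [set: R] (@cauchy_pdf R).
Proof. exact: (continuous_measurable_fun continuous_cauchy_pdf). Qed.

Lemma integral_cauchy_pdf : (\int[mu]_x (cauchy_pdf x)%:E = 1)%E.
Proof.
rewrite ge0_symfun_integralT//=; last 3 first.
- exact: cauchy_pdf_ge0.
- exact: continuous_cauchy_pdf.
- by move=> x; rewrite /cauchy_pdf /= sqrrN.
have -> : [set x : R | 0 <= x] = `[0, +oo[%classic.
  by apply/seteqP; split => x /=; rewrite in_itv/= andbT.
under eq_integral do rewrite pdfE EFinM.
rewrite ge0_integralZl//=.
- rewrite integral0y_oneDsqr -!EFinM; congr EFin.
  by rewrite mulKf ?gt_eqF ?pi_gt0// mulfV.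
- apply/measurable_EFinP/measurable_funTS.
  by apply: continuous_measurable_fun; exact: continuous_oneDsqrV.
- by rewrite lee_fin invr_ge0 pi_ge0.
Qed.

Let cauchy0 : @cauchy_prob R set0 = 0%E.
Proof. by rewrite /cauchy_prob integral_set0. Qed.

Let cauchy_ge0 A : (0 <= @cauchy_prob R A)%E.
Proof. by apply: integral_ge0 => x _; rewrite lee_fin cauchy_pdf_ge0. Qed.

Let cauchy_sigma_additive : semi_sigma_additive (@cauchy_prob R).
Proof.
move=> /= F mF tF mUF; rewrite /cauchy_prob; apply: cvg_toP.
  apply: ereal_nondecreasing_is_cvgn => m n mn.
  apply: lee_sum_nneg_natr => // k _ _; apply: integral_ge0 => /= x Fkx.
  by rewrite lee_fin cauchy_pdf_ge0.
rewrite ge0_integral_bigcup//=.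
- apply/measurable_funTS/measurableT_comp => //.
  exact: measurable_cauchy_pdf.
- by move=> x _; rewrite lee_fin cauchy_pdf_ge0.
Qed.

HB.instance Definition _ := isMeasure.Build _ _ _
  (@cauchy_prob R) cauchy0 cauchy_ge0 cauchy_sigma_additive.

Let cauchy_setT : @cauchy_prob R [set: R] = 1%E.
Proof. by rewrite /cauchy_prob integral_cauchy_pdf. Qed.

HB.instance Definition _ :=
  @Measure_isProbability.Build _ _ R (@cauchy_prob R) cauchy_setT.

End cauchy_probability.

(* The real c such that `]-oo, c[ and `]a, b[ have the same measure. It exists
   and is unique for a < b; otherwise no such c exists and the value is
   irrelevant. *)
Definition equal_mass_halfline {R : realType} (a b : R) : R :=
  get [set c : R | cauchy_prob `]-oo, c[ = cauchy_prob `]a, b[].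

(* Main.v *)
(* The distribution function of the measure is 1/2 + atan(x)/pi, so the defining
   equation of g(a, b) reads atan g = (atan b - atan a) - pi/2. Taking tangents,
   g = - cot(atan b - atan a) = - (1 + a b) / (b - a), from which
   g(ra, rb) - r g(a, b) = (r - 1)(r + 1) / (r (b - a)). *)

Require Import Defs.
From mathcomp Require Import all_boot all_order all_algebra.
From mathcomp Require Import all_classical all_reals all_analysis.
From mathcomp Require Import measurable_realfun ring lra.
Import Order.TTheory GRing.Theory Num.Theory.
Import numFieldNormedType.Exports.
Local Open Scope ring_scope.

Lemma derivable_atan_over_pi (R : realType) (x : R) :
  derivable (fun y : R => pi^-1 * atan y) x 1.
Proof. by apply: derivableM => //; exact: derivable_atan. Qed.

Lemma derive1_atan_over_pi (R : realType) :
  derive1 (fun y : R => pi^-1 * atan y) =1 cauchy_pdf.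
Proof.
move=> x; rewrite derive1Ml; last exact: derivable_atan.
by rewrite derive1_atan /cauchy_pdf invfM.
Qed.

Lemma continuous_atan_over_pi (R : realType) :
  continuous (fun y : R => pi^-1 * atan y).
Proof. by move=> x; apply: cvgM; [exact: cvg_cst|exact: continuous_atan]. Qed.

Lemma cauchy_prob_itvoo (R : realType) (a b : R) : a < b ->
  cauchy_prob `]a, b[ = (pi^-1 * (atan b - atan a))%:E.
Proof.
(* The endpoints carry no mass, so the integral may be taken over [[a, b]], where the fundamental
   theorem of calculus applies with antiderivative [pi^-1 * atan y]. *)
move=> ab; rewrite /cauchy_prob -(@integral_itv_bndoo _ _ _ _ true false).
  rewrite (continuous_FTC2 (F := fun y : R => pi^-1 * atan y)) //.
  - by rewrite -EFinB mulrBr.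
  - exact/continuous_subspaceT/continuous_cauchy_pdf.
  - split.
    + by move=> x _; exact: derivable_atan_over_pi.
    + exact/cvg_at_right_filter/continuous_atan_over_pi.
    + exact/cvg_at_left_filter/continuous_atan_over_pi.
  - by move=> x _; rewrite derive1_atan_over_pi.
by apply/measurable_EFinP/measurable_funTS; exact: measurable_cauchy_pdf.
Qed.

(** Complement of the upper tail, whose mass is the limit 1/2 of [pi^-1 * atan] at +oo minus its
    value at [c]. *)
Lemma cauchy_prob_itvNyo (R : realType) (c : R) :
  cauchy_prob `]-oo, c[ = (2^-1 + pi^-1 * atan c)%:E.
Proof.
have tailE : cauchy_prob `[c, +oo[ = (2^-1 - pi^-1 * atan c)%:E.
  rewrite /cauchy_prob
    (ge0_continuous_FTC2y (F := fun y : R => pi^-1 * atan y) (l := 2^-1)) //.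
  - by move=> x _; exact: cauchy_pdf_ge0.
  - exact/continuous_subspaceT/continuous_cauchy_pdf.
  - have -> : 2^-1 = pi^-1 * (pi / 2) :> R by rewrite mulKf ?gt_eqF ?pi_gt0.
    by apply: cvgM; [exact: cvg_cst|exact: cvgy_atan].
  - exact/cvg_at_right_filter/continuous_atan_over_pi.
  - by move=> x _; rewrite derive1_atan_over_pi.
rewrite -setCitvr probability_setC // [X in (_ - X)%E]tailE -EFinB; congr EFin; lra.
Qed.

Lemma equal_mass_halflineE (R : realType) (a b : R) : a < b ->
  equal_mass_halfline a b = - (1 + a * b) / (b - a).
Proof.
move=> ab; set t := atan b - atan a.
have [ua va ub vb] : [/\ - (pi / 2) < atan a, atan a < pi / 2,
    - (pi / 2) < atan b & atan b < pi / 2].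
  by rewrite !atan_gtNpi2 !atan_ltpi2.
have t_gt0 : 0 < t by rewrite subr_gt0 lt_atan.
have t_ltpi : t < pi by rewrite /t; lra.
have ca : cos (atan a) != 0 by rewrite gt_eqF // cos_gt0_pihalf // ua va.
have cb : cos (atan b) != 0 by rewrite gt_eqF // cos_gt0_pihalf // ub vb.
(* With this, sine and cosine of [t] become rational in [a], [b] times the common factor
   [cos (atan a) * cos (atan b)], which cancels in the tangent. *)
have sinE x : cos (atan x) != 0 -> sin (atan x) = x * cos (atan x) :> R.
  by move=> cx; rewrite -{2}(atanK x) /tan divfK.
have tanE : tan (t - pi / 2) = - (1 + a * b) / (b - a).
  rewrite /tan sinBpihalf cosBpihalf /t sinB cosB !sinE //.
  have ba : b - a != 0 by rewrite subr_eq0 gt_eqF.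
  field; rewrite ba /=.
  (* The denominator left by [field] is [sin t]; it factors into nonzero terms. *)
  have -> : b * cos (atan b) * cos (atan a) - cos (atan b) * (a * cos (atan a)) =
      (b - a) * (cos (atan b) * cos (atan a)) by ring.
  by rewrite !mulf_neq0.
(* Since [0 < t < pi], the angle [t - pi / 2] lies in the principal branch, so [atan] inverts [tan]
   there. *)
have atanE : atan (- (1 + a * b) / (b - a)) = t - pi / 2.
  by rewrite -tanE tanK // in_itv /=; apply/andP; split; lra.
have massE : cauchy_prob `]-oo, - (1 + a * b) / (b - a)[ = cauchy_prob `]a, b[.
  rewrite cauchy_prob_itvNyo cauchy_prob_itvoo // atanE /t; congr EFin.
  by rewrite mulrBr mulKf ?gt_eqF ?pi_gt0 // addrC subrK.
(* [massE] gives existence; uniqueness follows from the injectivity of [atan]. *)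
rewrite /equal_mass_halfline; apply: get_unique => //= c; rewrite -massE !cauchy_prob_itvNyo => -[].
have pi_neq0 : pi^-1 != 0 :> R by rewrite invr_neq0 // gt_eqF ?pi_gt0.
by move=> /addrI/(mulfI pi_neq0)/(can_inj (@atanK R)).
Qed.

Theorem theorem4 (R : realType) (a b r : R) (hab : a < b) (hr : 0 < r) :
  equal_mass_halfline (r * a) (r * b) >= r * equal_mass_halfline a b <-> r >= 1.
Proof.
have d_gt0 : 0 < b - a by rewrite subr_gt0.
rewrite !equal_mass_halflineE ?ltr_pM2l //.
have -> : - (1 + r * a * (r * b)) / (r * b - r * a) =
    r * (- (1 + a * b) / (b - a)) + (r - 1) * (r + 1) / (r * (b - a)).
  by field; rewrite -mulrBr !mulf_neq0 ?gt_eqF.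
(* As [r + 1] and [r * (b - a)] are positive, the added term has the sign of [r - 1]. *)
rewrite lerDl pmulr_lge0 ?invr_gt0 ?mulr_gt0 // pmulr_lge0 ?subr_ge0 //.
by rewrite addr_gt0.
Qed.
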